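(* Let $\epsilon>0$ and $\delta>0$, and let $I_0=(-2\delta,-\delta]\cup[\epsilon,2\epsilon)$. For every function $f:I_0\to\mathbb{R}$ there is a unique function $y:\mathbb{R}\setminus\{0\}\to\mathbb{R}$ such that $y(x)=y(2x)$ for all $x\in\mathbb{R}\setminus\{0\}$ and $y(x)=f(x)$ for all $x\in I_0$.
   Context: No continuity is assumed. *)

(* Defs.v *)
From HB Require Import structures.
From mathcomp Require Import all_boot all_order all_algebra.
From mathcomp Require Import boolp classical_sets functions set_interval reals.
From mathcomp Require Import lra.

Set Implicit Arguments.
Unset Strict Implicit.
Unset Printing Implicit Defensive.

Import Order.TTheory GRing.Theory Num.Theory.
Local Open Scope classical_set_scope.
Local Open Scope ring_scope.

Definition nonzero (R : realType) : set R := [set x | x != 0].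
Arguments nonzero : clear implicits.

Definition I0 (R : realType) (eps delta : R) : set R :=
  `](- (2 * delta)), (- delta)] `|` `[eps, (2 * eps)[.

Lemma nonzero_double (R : realType) (x : R) : nonzero R x -> nonzero R (2 * x).
Proof. by move=> x0; rewrite /nonzero /= mulf_neq0// pnatr_eq0. Qed.

Definition nz_double (R : realType) (x : nonzero R) : nonzero R :=
  SigSub (mem_set (nonzero_double (set_valP x))).

Lemma I0_nonzero (R : realType) (eps delta : R) :
  0 < eps -> 0 < delta -> I0 eps delta `<=` nonzero R.
Proof.
move=> e0 d0 x; rewrite /I0 /nonzero /= !in_itv /=.
by case=> /andP[h1 h2]; apply/eqP => x0; lra.
Qed.

(* Main.v *)
(** Every nonzero real is a power of 2 times exactly one point of [I0]: the
    positive reals are tiled by the translates [2^n [eps, 2 eps)], the negative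
    ones by [2^n (- 2 delta, - delta]].  A function invariant under doubling is
    thus the same as a function on [I0]. *)
Require Import Defs.
From HB Require Import structures.
From mathcomp Require Import all_boot all_order all_algebra.
From mathcomp Require Import boolp classical_sets functions set_interval reals.
From mathcomp Require Import lra.

Import Order.TTheory GRing.Theory Num.Theory.
Local Open Scope classical_set_scope.
Local Open Scope ring_scope.

Set Implicit Arguments.
Unset Strict Implicit.

(* Natural exponents on both sides stand for [x = 2 ^ (n - m) * z] with
   [n - m] a possibly negative integer. *)
Definition dyadic_equiv (R : realType) (x z : R) : Prop :=
  exists m n : nat, 2 ^+ m * x = 2 ^+ n * z.

Lemma dyadic_equiv_sym (R : realType) (x z : R) :
  dyadic_equiv x z -> dyadic_equiv z x.
Proof. by move=> [m [n E]]; exists n, m. Qed.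

Lemma dyadic_equiv_trans (R : realType) (x z w : R) :
  dyadic_equiv x z -> dyadic_equiv z w -> dyadic_equiv x w.
Proof.
move=> [m [n E1]] [p [q E2]]; exists (p + m)%N, (n + q)%N.
by rewrite !exprD -!mulrA E1 -E2 mulrCA.
Qed.

Lemma dyadic_equivN (R : realType) (x z : R) :
  dyadic_equiv (- x) (- z) -> dyadic_equiv x z.
Proof. by move=> [m [n]]; rewrite !mulrN => /oppr_inj E; exists m, n. Qed.

Lemma dyadic_equiv_gt0 (R : realType) (x z : R) :
  dyadic_equiv x z -> (0 < x) = (0 < z).
Proof.
move=> [m [n E]].
by rewrite -(pmulr_rgt0 x (exprn_gt0 m (ltr0Sn R 1))) E pmulr_rgt0 ?exprn_gt0.
Qed.

Lemma dyadic_equiv_double (R : realType) (x : R) : dyadic_equiv x (2 * x).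
Proof. by exists 1%N, 0%N; rewrite expr1 expr0 mul1r. Qed.

(** Scale [x] up by [2 ^+ m] until it exceeds [e], then halve as often as needed: for the least [k]
    with [2 ^+ m * x < 2 ^+ k.+1 * e], the point [2 ^+ m * x / 2 ^+ k] lies in the interval. *)
Lemma dyadic_equiv_exists (R : realType) (e x : R) : 0 < e -> 0 < x ->
  exists2 i, e <= i < 2 * e & dyadic_equiv x i.
Proof.
move=> e0 x0.
(* Archimedean property: some natural [n] exceeds [a / b], and [n < 2 ^ n]. *)
have dom (a b : R) : 0 < a -> 0 < b -> exists n, a < 2 ^+ n * b.
  move=> a0 b0; exists (Num.bound (a / b)); rewrite -ltr_pdivrMr//.
  apply: (lt_trans (archi_boundP _)); first by rewrite divr_ge0// ltW.
  by rewrite -natrX ltr_nat ltn_expl.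
have [m lem] := dom _ _ e0 x0.
have exk : exists k, 2 ^+ m * x < 2 ^+ k.+1 * e.
  have [k ltk] := dom (2 ^+ m * x) e (mulr_gt0 (exprn_gt0 m (ltr0Sn R 1)) x0) e0.
  exists k; apply: (lt_le_trans ltk).
  by rewrite ler_pM2r// ler_weXn2l// ler1n.
case: (ex_minnP exk) => k ltk mink.
have p0 : 0 < 2 ^+ k :> R by rewrite exprn_gt0.
exists (2 ^+ m * x / 2 ^+ k); last first.
  by exists m, k; rewrite [RHS]mulrC divfK// gt_eqF.
rewrite ler_pdivlMr// ltr_pdivrMr// mulrAC -exprS ltk andbT.
(* Minimality of [k] gives the lower bound only for a successor; for [k = 0] it is the choice of [m]
   that gives [e <= 2 ^+ m * x]. *)
case: k {ltk p0} mink => [_|k mink]; first by rewrite expr0 mulr1 ltW.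
by rewrite mulrC leNgt; apply/negP => /mink; rewrite ltnn.
Qed.

(** Cancelling powers leaves [i = 2 ^+ (n - m) * j] with [m <= n]. A positive exponent would force
    [i >= 2 * j >= 2 * e], outside the interval. *)
Lemma dyadic_equiv_uniq (R : realType) (e i j : R) : 0 < e ->
  e <= i < 2 * e -> e <= j < 2 * e -> dyadic_equiv i j -> i = j.
Proof.
move=> e0 + + [m [n]].
wlog le_mn : i j m n / (m <= n)%N => [H hi hj E|].
  case: (leqP m n) => [le_mn|/ltnW le_nm]; first exact: H E.
  by apply/esym; exact: H (esym E).
rewrite -(subnKC le_mn) exprD -mulrA => /andP[_ lti] /andP[lej _].
move/mulfI => E; move: lti; rewrite {}E ?expf_neq0 ?pnatr_eq0//.
case: (n - m)%N => [|k]; first by rewrite expr0 mul1r.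
rewrite exprS -mulrA ltr_pM2l// => /lt_le_trans/(_ lej).
rewrite gtr_pMl ?(lt_le_trans e0 lej)// ltNge.
by rewrite exprn_ege1// ler1n.
Qed.

Lemma mem_I0_pos (R : realType) (eps delta x : R) : 0 < delta -> 0 < x ->
  I0 eps delta x <-> eps <= x < 2 * eps.
Proof.
move=> d0 x0; rewrite /I0 /= !in_itv /=; split; last by right.
by case=> // /andP[_ xd]; lra.
Qed.

(** Reflection reverses which end is closed, so the negative half takes the shape of the positive
    one and the lemmas on positive reals apply with [e := delta]. *)
Lemma mem_I0_neg (R : realType) (eps delta x : R) : 0 < eps -> x < 0 ->
  I0 eps delta x <-> delta <= - x < 2 * delta.
Proof.
move=> e0 x0; rewrite /I0 /= !in_itv /= [delta <= - x]lerNr [- x < _]ltrNl andbC.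
by split; [case=> // /andP[ex _]; lra | left].
Qed.

Lemma I0_dyadic_exists (R : realType) (eps delta x : R) :
  0 < eps -> 0 < delta -> x != 0 ->
  exists2 i, I0 eps delta i & dyadic_equiv x i.
Proof.
move=> e0 d0; rewrite neq_lt => /orP[xlt0|xgt0].
  have nx0 : 0 < - x by rewrite oppr_gt0.
  have [i hi xi] := dyadic_equiv_exists d0 nx0.
  exists (- i); last by apply: dyadic_equivN; rewrite opprK.
  apply/mem_I0_neg; rewrite ?opprK// oppr_lt0.
  by rewrite -(dyadic_equiv_gt0 xi).
have [i hi xi] := dyadic_equiv_exists e0 xgt0.
by exists i => //; apply/mem_I0_pos; rewrite // -(dyadic_equiv_gt0 xi).
Qed.

(** Scaling by powers of 2 preserves sign, so both points lie in the same half of [I0], where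
    [dyadic_equiv_uniq] applies. *)
Lemma I0_dyadic_uniq (R : realType) (eps delta i j : R) :
  0 < eps -> 0 < delta -> I0 eps delta i -> I0 eps delta j ->
  dyadic_equiv i j -> i = j.
Proof.
move=> e0 d0 hi hj ij; have sgn := dyadic_equiv_gt0 ij.
have := I0_nonzero e0 d0 hi; rewrite /nonzero /= neq_lt => /orP[ilt0|igt0].
  have jlt0 : j < 0.
    by rewrite lt_neqAle (I0_nonzero e0 d0 hj) leNgt -sgn -leNgt ltW.
  apply: oppr_inj; apply: (dyadic_equiv_uniq d0) => //.
  - exact/(mem_I0_neg delta e0).
  - exact/(mem_I0_neg delta e0).
  - by apply: dyadic_equivN; rewrite !opprK.
by apply: (dyadic_equiv_uniq e0) => //;
  apply/(mem_I0_pos eps d0); rewrite // -sgn.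
Qed.

(** Iterated doubling moves [x] and [z] to one common point without changing the value of [y]. *)
Lemma double_invariant_dyadic (R : realType) (T : Type) (y : nonzero R -> T) :
  (forall x, y x = y (nz_double x)) ->
  forall x z : nonzero R, dyadic_equiv (set_val x) (set_val z) -> y x = y z.
Proof.
move=> y2.
have yX n x : y x = y (iter n (@nz_double R) x) by elim: n => //= n ->.
have valX n x : set_val (iter n (@nz_double R) x) = 2 ^+ n * set_val x.
  by elim: n => [|n IH]; rewrite ?expr0 ?mul1r// exprS -mulrA -IH.
move=> x z [m [n E]]; rewrite (yX m x) (yX n z); congr y.
by apply: val_inj; move: E; rewrite -!valX.
Qed.

Unset Implicit Arguments.

Theorem theorem3p7 (R : realType) (eps delta : R)
    (heps : 0 < eps) (hdelta : 0 < delta) (f : I0 eps delta -> R) :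
  exists! y : nonzero R -> R,
    (forall x : nonzero R, y x = y (nz_double x)) /\
    (forall x : I0 eps delta, y (subfun (I0_nonzero heps hdelta) x) = f x).
Proof.
have /choice[r rE] (x : nonzero R) :
    exists i : I0 eps delta, dyadic_equiv (set_val x) (set_val i).
  have [i hi xi] := I0_dyadic_exists heps hdelta (set_valP x).
  by exists (SigSub (mem_set hi)).
have r_uniq (x : nonzero R) (i : I0 eps delta) :
    dyadic_equiv (set_val x) (set_val i) -> r x = i.
  move=> xi; apply: val_inj.
  apply: (I0_dyadic_uniq heps hdelta (set_valP _) (set_valP _)).
  exact: dyadic_equiv_trans (dyadic_equiv_sym (rE x)) xi.
have dyadic_refl (x : R) : dyadic_equiv x x by exists 0%N, 0%N.
(* [r] picks the representative in [I0]. It is invariant because [x], [2 * x] and [r (2 * x)] are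
   equivalent, and it fixes [I0] by reflexivity. *)
exists (f \o r); split=> [|y [y2 yf]].
  split=> x /=; congr f; apply: r_uniq; last exact: dyadic_refl.
  exact: dyadic_equiv_trans (dyadic_equiv_double _) (rE (nz_double x)).
(* Any solution [y] takes equal values at [x] and at its representative [r x], where it is given by
   [f]. *)
apply/funext => x /=; rewrite -yf; apply/esym.
exact: (double_invariant_dyadic y2).
Qed.
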